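(* Let $\mathfrak g$ be a $7$-dimensional $2$-step nilpotent real Lie algebra with a basis $\{e_1,\dots,e_7\}$ whose dual basis satisfies $$de^i=0\ (i=1,\dots,6),\qquad de^7=a\,e^{12}+b\,e^{34}+c\,e^{56},$$ with $a,b,c\in\mathbb R$ not all zero, and with the $\mathrm G_2$-structure $$\varphi=e^{127}+e^{347}+e^{567}+e^{135}-e^{146}-e^{236}-e^{245}.$$ Set $\mu=a+b+c$ and let $\lambda\in\mathbb R$. If the connection $\nabla^\lambda$ is a $\mathrm G_2$-instanton, then $\lambda=1$ and $\mu=0$.
   Context: Notation: $e^{ij\cdots}=e^i\wedge e^j\wedge\cdots$; $d$ is the Chevalley–Eilenberg differential, $d\xi(x,y)=-\xi([x,y])$. The form $\varphi$ induces the inner product $g$ for which $\{e_i\}$ is orthonormal, and the orientation $e^{1234567}$, hence a Hodge star $\star$; put $\psi=\star\varphi$ (here $d\psi=0$, i.e. $\varphi$ is coclosed). For $\lambda\in\mathbb R$, the metric connection $\nabla^\lambda$ is defined by $g(\nabla^\lambda_xy,z)=g(\nabla^g_xy,z)+\frac\lambda2T(x,y,z)$ for $x,y,z\in\mathfrak g$, where $\nabla^g$ is the Levi-Civita connection of the left-invariant metric $g$ on a Lie group with Lie algebra $\mathfrak g$ and $T=\frac16\star(d\varphi\wedge\varphi)\varphi-\star d\varphi$. Its curvature is $R^\lambda_{x,y}=[\nabla^\lambda_x,\nabla^\lambda_y]-\nabla^\lambda_{[x,y]}$. $\nabla^\lambda$ is a $\mathrm G_2$-instanton if $R^\lambda\wedge\psi=0$,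 i.e. for all $u,v\in\mathfrak g$ the 2-form $(x,y)\mapsto g(R^\lambda_{x,y}u,v)$ wedged with $\psi$ vanishes. *)

(* Defs.v *)
From HB Require Import structures.
From mathcomp Require Import all_boot all_order all_fingroup all_algebra.
From mathcomp Require Import boolp functions reals.

Set Implicit Arguments.
Unset Strict Implicit.
Unset Printing Implicit Defensive.

Import Order.TTheory GRing.Theory Num.Theory.
Local Open Scope ring_scope.

Section Forms.
Context {R : realType} {V : vectType R}.

(* A k-form is represented by its values on k-tuples of vectors; alternation
   and multilinearity are not part of the type, all forms below have them. *)
Definition kform (k : nat) := k.-tuple V -> R.

(* (al /\ be)(v_1,...,v_{p+q})
     = 1/(p! q!) \sum_s sgn(s) al(v_s(1),...,v_s(p)) be(v_s(p+1),...,v_s(p+q)),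
   so that (xi /\ eta)(x, y) = xi(x) eta(y) - xi(y) eta(x) for 1-forms. *)
Definition wedge (p q : nat) (al : kform p) (be : kform q) : kform (p + q) :=
  fun v => (p`!%:R * q`!%:R)^-1 *
    \sum_(s : 'S_(p + q)) (-1) ^+ s
      * al [tuple tnth v (s (lshift q i)) | i < p]
      * be [tuple tnth v (s (rshift p j)) | j < q].

(* The Chevalley-Eilenberg differential (trivial coefficients):
     (d w)(x_0,...,x_{k+1})
       = \sum_(i < j) (-1)^(i+j) w([x_i, x_j], x_0,..^i..^j..,x_{k+1}).
   The index j > i is written lift i j, with i <= j; then lift i (lift j m),
   for m < k, enumerates in order the indices other than i and lift i j. *)
Definition ce_diff (br : V -> V -> V) (k : nat) (w : kform k.+1) : kform k.+2 :=
  fun x => \sum_(i < k.+2) \sum_(j < k.+1 | (i <= j)%N)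
    (-1) ^+ (i + lift i j) *
    w [tuple of br (tnth x i) (tnth x (lift i j))
             :: [tuple tnth x (lift i (lift j m)) | m < k]].

(* The Hodge star of the inner product with orthonormal basis e and of the
   volume form vol: it sends e^I to sgn(I, J) e^J when vol is the wedge of the
   dual basis and J is the complement of I. *)
Definition hodge (p q : nat) (e : (p + q).-tuple V) (vol : kform (p + q))
    (be : kform p) : kform q :=
  fun v => (p`!%:R)^-1 *
    \sum_(f : {ffun 'I_p -> 'I_(p + q)})
      be [tuple tnth e (f i) | i < p]
      * vol [tuple of [tuple tnth e (f i) | i < p] ++ v].

(* The 1-form e^i of the dual basis, i = 1, ..., 7, and e^{ij...}, e.g.
   e^{127} is dual_mono e [:: 1; 2; 7]. *)
Definition dual_form (e : 7.-tuple V) (i : nat) : kform 1 :=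
  fun v => coord e (inord i.-1) (thead v).

Definition dual_mono (e : 7.-tuple V) : forall s : seq nat, kform (size s) :=
  fix mono (s : seq nat) : kform (size s) :=
    match s return kform (size s) with
    | [::] => fun=> 1
    | i :: s' => wedge (dual_form e i) (mono s')
    end.
Arguments dual_mono e s : clear implicits.

Definition metric (e : 7.-tuple V) (x y : V) : R :=
  \sum_(i < 7) coord e i x * coord e i y.

Definition volume (e : 7.-tuple V) : kform 7 :=
  dual_mono e [:: 1; 2; 3; 4; 5; 6; 7]%N.

Definition g2_phi (e : 7.-tuple V) : kform 3 :=
  (dual_mono e [:: 1; 2; 7]%N : kform 3) + (dual_mono e [:: 3; 4; 7]%N : kform 3)
  + (dual_mono e [:: 5; 6; 7]%N : kform 3)
  + (dual_mono e [:: 1; 3; 5]%N : kform 3)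
  - (dual_mono e [:: 1; 4; 6]%N : kform 3)
  - (dual_mono e [:: 2; 3; 6]%N : kform 3)
  - (dual_mono e [:: 2; 4; 5]%N : kform 3).

Definition g2_psi (e : 7.-tuple V) : kform 4 :=
  @hodge 3 4 e (volume e) (g2_phi e).

(* T = 1/6 *(d phi /\ phi) phi - *d phi; *(d phi /\ phi) is a 0-form, hence
   its evaluation at the empty tuple. *)
Definition g2_torsion (br : V -> V -> V) (e : 7.-tuple V) : kform 3 :=
  let phi := g2_phi e in
  let dphi := ce_diff br phi : kform 4 in
  fun v => 6%:R^-1 * @hodge 7 0 e (volume e) (wedge dphi phi) [tuple] * phi v
           - @hodge 4 3 e (volume e) dphi v.

Record lie_bracket (br : V -> V -> V) : Prop := LieBracket {
  lie_alternating : forall x, br x x = 0;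
  lie_jacobi : forall x y z,
    br x (br y z) + br y (br z x) + br z (br x y) = 0
}.

Definition two_step_nilpotent (br : V -> V -> V) : Prop :=
  (forall x y z, br (br x y) z = 0) /\ (exists x y, br x y <> 0).

(* Left-invariant connections are bilinear maps V -> V -> V. As g(y, z) is
   constant for left-invariant y and z, compatibility with g loses its
   derivative term. *)
Record levi_civita (br : V -> V -> V) (g : V -> V -> R) (D : V -> V -> V)
    : Prop := LeviCivita {
  lc_torsion_free : forall x y, D x y - D y x = br x y;
  lc_metric : forall x y z, g (D x y) z + g y (D x z) = 0
}.

Definition nabla_lambda (br : V -> V -> V) (e : 7.-tuple V)
    (Dg : V -> V -> V) (lambda : R) (D : V -> V -> V) : Prop :=
  forall x y z, metric e (D x y) z =
    metric e (Dg x y) z + lambda / 2%:R * g2_torsion br e [tuple x; y; z].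

Definition curvature (br D : V -> V -> V) (x y u : V) : V :=
  D x (D y u) - D y (D x u) - D (br x y) u.

Definition curvature_form (br : V -> V -> V) (e : 7.-tuple V)
    (D : V -> V -> V) (u v : V) : kform 2 :=
  fun t => metric e (curvature br D (tnth t ord0) (tnth t ord_max) u) v.

Definition g2_instanton (br : V -> V -> V) (e : 7.-tuple V)
    (D : V -> V -> V) : Prop :=
  forall u v, wedge (curvature_form br e D u v) (g2_psi e) = 0.

End Forms.

Arguments kform {R} V k.
Arguments dual_mono {R V} e s.

(* Main.v *)
Require Import Defs.
From mathcomp Require Import all_boot all_order all_fingroup all_algebra.
From mathcomp Require Import boolp functions reals.
From mathcomp Require Import ring lra.

Set Implicit Arguments.
Unset Strict Implicit.
Unset Printing Implicit Defensive.

Import Order.TTheory GRing.Theory Num.Theory.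
Local Open Scope ring_scope.

(** Write F = de^7 = a e^{12} + b e^{34} + c e^{56}; the only brackets are
    [e_i, e_j] = - F_ij e_7. With omega = e^{12} + e^{34} + e^{56} one gets
    d phi = omega /\ F (dphiE), hence *(d phi /\ phi) = 2 mu and an explicit
    torsion T (g2_torsionE). The Koszul formula then makes every entry of the
    curvature of nabla^lambda an explicit polynomial in a, b, c and lambda
    (curvature_formE).

    A 2-form A satisfies A /\ psi = 0 iff it is orthogonal to the seven
    2-forms obtained by inserting one e_k in phi, that is
    \sum_{i<j} phi_kij A_ij = 0 for all k. Take k = 1, 3, 5
    (wedge_psi_contraction). Applied to the curvature in the
    entries (e_2, e_7), (e_4, e_7), (e_6, e_7), these equations give
      (lambda + 1) (2 lambda mu (mu - p) + 3 (lambda - 1) p^2) = 0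
    for p = a, b, c, and in the entries (e_3, e_5), (e_5, e_1), (e_1, e_3)
      lambda (lambda - 3) mu (p + q) = 3 (lambda - 1)^2 p q
    for the three pairs {p, q} from a, b, c.

    Put s = a^2 + b^2 + c^2 > 0 and e2 = ab + bc + ca, so mu^2 = s + 2 e2.
    Summing the second family at lambda = -1 gives 2 mu^2 = 3 e2, that is
    mu^2 + 3 s = 0, which is absurd. For lambda <> -1 the sums of the two
    families are
      4 lambda mu^2 + 3 (lambda - 1) s = 0  and
      2 lambda (lambda - 3) mu^2 = 3 (lambda - 1)^2 e2;
    eliminating s and e2 leaves (3 lambda^2 + 2 lambda + 3) mu^2 = 0, whose
    first factor has negative discriminant. So mu = 0, and then lambda = 1
    because s > 0 (instanton_system_solution).

    To compute with forms, a monomial e^{i1...ip} is written as an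
    antisymmetrised product of coordinates. Wedge products of monomials are
    then concatenations of words (wedge_mono), and inserting basis vectors,
    and with it the Hodge star, deletes letters from a word up to a sign
    (mono_contract, hodge_form), so that evaluating forms becomes a
    computation on lists of indices. *)

(** * Wedge products of antisymmetrised functions *)

Section BlockPerm.
Context {p q : nat}.

Definition block_fun (s : 'S_p) (t : 'S_q) (i : 'I_(p + q)) : 'I_(p + q) :=
  unsplit (match fintype.split i with inl j => inl (s j) | inr k => inr (t k) end).

Lemma block_fun_inj s t : injective (block_fun s t).
Proof.
move=> i j /(can_inj unsplitK); rewrite -{2}[i]splitK -{2}[j]splitK.
by case: (fintype.split i) => x; case: (fintype.split j) => y // [/perm_inj->].
Qed.

Definition block_perm s t : 'S_(p + q) := perm (@block_fun_inj s t).

Lemma block_permL s t i : block_perm s t (lshift q i) = lshift q (s i).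
Proof. by rewrite permE /block_fun (unsplitK (inl _ i)). Qed.

Lemma block_permR s t i : block_perm s t (rshift p i) = rshift p (t i).
Proof. by rewrite permE /block_fun (unsplitK (inr _ i)). Qed.

(** The permutation matrix of a block permutation is block diagonal, and the
    sign of a permutation is the determinant of its matrix. *)
Lemma sign_block_perm (R : comNzRingType) s t :
  (-1) ^+ block_perm s t = (-1) ^+ s * (-1) ^+ t :> R.
Proof.
rewrite -!det_perm -(det_lblock _ 0); congr (\det _).
apply/matrixP=> i j; rewrite -[i]splitK -[j]splitK.
case: (fintype.split i) => x; case: (fintype.split j) => y /=.
- by rewrite block_mxEul !mxE block_permL (inj_eq (@lshift_inj _ _)).
- by rewrite block_mxEur !mxE block_permL eq_lrshift.
- by rewrite block_mxEdl !mxE block_permR eq_rlshift.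
- by rewrite block_mxEdr !mxE block_permR (inj_eq (@rshift_inj _ _)).
Qed.

End BlockPerm.

Section AlternatingSum.
Context {R : realType} {V : vectType R}.

Definition altsum (n : nat) (f : kform V n) : kform V n :=
  fun v => \sum_(s : 'S_n) (-1) ^+ s * f [tuple tnth v (s i) | i < n].

Lemma altsum_perm n (f : kform V n) (t : 'S_n) v :
  altsum f [tuple tnth v (t i) | i < n] = (-1) ^+ t * altsum f v.
Proof.
rewrite /altsum [in RHS](reindex_inj (mulIg t)) mulr_sumr /=.
apply: eq_bigr => s _; rewrite odd_permM signr_addb mulrA mulrCA -expr2 sqrr_sign.
rewrite mulr1; congr (_ * f _).
by apply: eq_from_tnth => i; rewrite !tnth_mktuple permM.
Qed.

Lemma altsum1 (f : kform V 1) : altsum f = f.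
Proof.
apply: funext => v; rewrite /altsum (bigD1 1%g) //= big1 => [|s].
  rewrite odd_perm1 mul1r addr0; congr f.
  by apply: eq_from_tnth => i; rewrite tnth_mktuple perm1.
by case/eqP; apply/permP => i; rewrite !ord1.
Qed.

Definition tensor (p q : nat) (f : kform V p) (g : kform V q) :
    kform V (p + q) :=
  fun v => f [tuple tnth v (lshift q i) | i < p]
           * g [tuple tnth v (rshift p j) | j < q].

(** Expanding both antisymmetrisations, the term of a pair (s, t) is absorbed
    in the outer sum by translating by the block permutation of s and t, with
    the right sign; each of the p! q! pairs thus contributes the same amount,
    which cancels the normalisation of the wedge. *)
Lemma wedge_altsum p q (f : kform V p) (g : kform V q) :
  wedge (altsum f) (altsum g) = altsum (tensor f g).
Proof.
apply: funext => v; rewrite /wedge.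
transitivity ((p`!%:R * q`!%:R)^-1 * \sum_(x : 'S_p * 'S_q)
                altsum (tensor f g) v).
  congr (_ * _); under eq_bigr => s _.
    rewrite -mulrA big_distrlr /= pair_big mulr_sumr /=; over.
  rewrite exchange_big /=; apply: eq_bigr => -[s t] _ /=.
  rewrite /altsum [in RHS](reindex_inj (mulgI (block_perm s t))) /=.
  apply: eq_bigr => r _; rewrite odd_permM signr_addb sign_block_perm.
  rewrite [_ * (-1) ^+ r]mulrC -!mulrA; congr (_ * (_ * _)).
  rewrite /tensor mulrCA; congr (_ * (f _ * g _));
    apply: eq_from_tnth => i; rewrite !tnth_mktuple permM.
  + by rewrite block_permL.
  + by rewrite block_permR.
rewrite sumr_const card_prod !card_Sn -(mulr_natl (altsum _ _)) natrM mulrA.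
rewrite mulVf ?mul1r //.
by rewrite -natrM pnatr_eq0 -lt0n muln_gt0 !fact_gt0.
Qed.

End AlternatingSum.

(** * Monomial forms and contraction with basis vectors *)

Section Monomials.
Context {R : realType} {V : vectType R} (e : 7.-tuple V).

(** Indices run from 1 to 7, as in the usual notation e^{12} for 2-forms. *)
Definition crd (i : nat) (x : V) : R := coord e (inord i.-1) x.
Definition evec (i : nat) : V := tnth e (inord i.-1).

Definition is_index (i : nat) : bool := (0 < i <= 7)%N.

(** The monomial e^{s_1 ... s_p}. The degree is an argument of its own, so
    that the degree of a product of monomials is literally a sum. *)
Definition mono (p : nat) (s : seq nat) : kform V p :=
  altsum (fun v => \prod_(i < p) crd (nth 0%N s i) (tnth v i)).

Arguments mono p s : clear implicits.

Lemma wedge_mono p q s t : size s = p ->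
  wedge (mono p s) (mono q t) = mono (p + q) (s ++ t).
Proof.
move=> sz; rewrite wedge_altsum; congr altsum; apply: funext => v.
rewrite big_split_ord /=; congr (_ * _); apply: eq_bigr => i _;
  rewrite tnth_mktuple nth_cat sz.
- by rewrite ltn_ord.
- by rewrite ltnNge leq_addr addKn.
Qed.

Lemma mono_det p s (v : p.-tuple V) :
  mono p s v = \det (\matrix_(i, j) crd (nth 0%N s i) (tnth v j)).
Proof.
apply: eq_bigr => t _; congr (_ * _); apply: eq_bigr => i _.
by rewrite mxE tnth_mktuple.
Qed.

Lemma mono0 s (v : 0.-tuple V) : mono 0 s v = 1.
Proof. by rewrite mono_det det_mx00. Qed.

Lemma dual_monoE s : dual_mono e s = mono (size s) s.
Proof.
elim: s => [|i s IHs]; first by apply: funext => v; exact/esym/mono0.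
have <- : wedge (mono 1 [:: i]) (mono (size s) s) = mono (1 + size s) (i :: s).
  by rewrite wedge_mono.
rewrite -IHs /mono altsum1; congr (@wedge _ _ 1 (size s) _ _).
by apply: funext => u; rewrite big_ord1.
Qed.

Lemma mono_expand p l x (t : p.-tuple V) : size l = p.+1 ->
  mono p.+1 l [tuple of x :: t] =
  \sum_(i < p.+1)
    (-1) ^+ i * crd (nth 0%N l i) x * mono p (take i l ++ drop i.+1 l) t.
Proof.
move=> sz; rewrite mono_det (expand_det_col _ ord0).
apply: eq_bigr => i _; rewrite mxE tnth0 /cofactor addn0 mulrCA mulrA.
rewrite mono_det; congr (_ * \det _); apply/matrixP => j k; rewrite !mxE tnthS.
congr crd; rewrite nth_cat size_take sz ltn_ord nth_drop /= /bump.
case: ltnP => [lt_j | le_j]; last by rewrite addSn subnKC.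
by rewrite nth_take // add0n.
Qed.

Definition etuple (n : nat) (w : seq nat) : n.-tuple V :=
  [tuple evec (nth 0%N w i) | i < n].
Arguments etuple n w : clear implicits.

Lemma map_etuple n w : size w = n -> tval (etuple n w) = map evec w.
Proof.
move=> sz; rewrite /= -[in RHS](mkseq_nth 0%N w) sz /mkseq -val_enum_ord.
by rewrite -!map_comp.
Qed.

(** Deletes the letters of s from l one after the other, the boolean being
    the parity of the positions at which they are found; the result is None
    if some letter is missing. It computes the interior product of the
    monomial of l with the basis vectors named by s, see mono_contract. *)
Fixpoint contract (s l : seq nat) : option (bool * seq nat) :=
  if s is a :: s' then
    if a \in l then
      if contract s' (rem a l) is Some (b, l') then
        Some (odd (index a l) (+) b, l')
      else None
    else None
  else Some (false, l).

Hypothesis e_basis : basis_of fullv e.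

Lemma crd_evec i j : is_index i -> is_index j -> crd i (evec j) = (i == j)%:R.
Proof.
move=> /andP[i0 i7] /andP[j0 j7].
rewrite /crd /evec (tnth_nth 0) coord_free ?(basis_free e_basis) //.
rewrite eq_sym -(inj_eq val_inj) /= !inordK ?prednK //.
by case: i j i0 j0 {i7 j7} => [|i] [|j].
Qed.

(** In the expansion of the determinant along its first column, which is the
    basis vector of index a, only the row of the letter a survives. *)
Lemma mono_evec_cons p l a (t : p.-tuple V) :
    uniq l -> all is_index l -> is_index a -> size l = p.+1 ->
  mono p.+1 l [tuple of evec a :: t] =
  if a \in l then (-1) ^+ odd (index a l) * mono p (rem a l) t else 0.
Proof.
move=> ul il ia sz; rewrite mono_expand //.
have entry (i : 'I_p.+1) : crd (nth 0%N l i) (evec a) = (nth 0%N l i == a)%:R.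
  by rewrite crd_evec // (allP il) // mem_nth // sz.
have [al | al] := boolP (a \in l); last first.
  rewrite big1 // => i _; rewrite entry.
  case: eqP => [ai | _]; last by rewrite mulr0 mul0r.
  by rewrite -ai mem_nth ?sz in al.
have lt_a : (index a l < p.+1)%N by rewrite -sz index_mem.
rewrite (bigD1 (Ordinal lt_a)) //= [X in _ + X]big1 ?addr0 => [|i ne_i].
  by rewrite nth_index // crd_evec // eqxx mulr1 signr_odd remE.
rewrite entry; case: eqP => [ai | _]; last by rewrite mulr0 mul0r.
by case/eqP: ne_i; apply: val_inj; rewrite /= -ai index_uniq ?sz.
Qed.

Lemma mono_contract s p q l (v : q.-tuple V) (w : (p + q).-tuple V) :
    uniq l -> all is_index l -> all is_index s ->
    size s = p -> size l = (p + q)%N ->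
    tval w = map evec s ++ v ->
  mono (p + q) l w =
  if contract s l is Some (b, l') then (-1) ^+ b * mono q l' v else 0.
Proof.
elim: s p l w => [|a s IHs] [|p] l w //= ul il + sp sz wE.
  by move=> _; rewrite mul1r; congr (mono q l _); apply: val_inj.
case/andP=> ia is_; case: sp => sp.
have -> : w = [tuple of evec a :: [tuple of behead w]].
  by apply: val_inj; rewrite /= wE.
rewrite mono_evec_cons //; case: ifP => // al.
rewrite (IHs p (rem a l)) ?rem_uniq //=.
- case: (contract s _) => [[b l']|]; last by rewrite mulr0.
  by rewrite mulrA signr_addb.
- by apply/allP => x /mem_rem /(allP il).
- by rewrite size_rem // sz.
- by rewrite wE.
Qed.

(** The p! maps f that enumerate the letters of s are the only ones at which
    the monomial does not vanish. They differ by permutations, whose signs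
    occur once in the monomial and once in the antisymmetric volume form, and
    cancel. The basis d is e itself, retyped as a (p + q)-tuple. *)
Lemma hodge_monoE p q (d : (p + q).-tuple V) (g : kform V (p + q)) s v :
    (p + q = 7)%N -> tval d = tval e -> all is_index s -> size s = p ->
  @hodge R V p q d (altsum g) (mono p s) v =
  altsum g [tuple of etuple p s ++ v].
Proof.
move=> pq7 de si sz.
have lt_s (i : 'I_p) : ((nth 0%N s i).-1 < p + q)%N.
  have /(allP si) /andP[] : nth 0%N s i \in s by rewrite mem_nth ?sz.
  by rewrite pq7; case: (nth _ _ _).
pose fs := [ffun i : 'I_p => Ordinal (lt_s i)].
have tnth_d j : tnth d j = evec j.+1.
  rewrite /evec !(tnth_nth 0) de inordK //=.
  by rewrite -[7%N]pq7.
have monof (f : {ffun 'I_p -> 'I_(p + q)}) :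
    mono p s [tuple tnth d (f i) | i < p] =
    \sum_(t : 'S_p) (-1) ^+ t * (f == [ffun i => fs ((t^-1)%g i)])%:R.
  apply: eq_bigr => t _; congr (_ * _).
  have crdf (i : 'I_p) : crd (nth 0%N s i) (tnth d (f (t i))) = (f (t i) == fs i)%:R.
    have isi : is_index (nth 0%N s i) by rewrite (allP si) // mem_nth ?sz.
    have ift : is_index (f (t i)).+1 by rewrite /is_index ltn0Sn -pq7 ltn_ord.
    rewrite tnth_d crd_evec // -(inj_eq val_inj) ffunE /= eq_sym.
    by case: (nth 0%N s i) isi.
  under eq_bigr => i _ do rewrite !tnth_mktuple crdf.
  case: eqP => [-> | ne_f].
    by rewrite big1 // => i _; rewrite !ffunE permK eqxx.
  have [i ne_i] : exists i, f (t i) != fs i.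
    apply/existsP; rewrite -negb_forall; apply/negP => /forallP eqf.
    apply: ne_f; apply/ffunP => i; rewrite ffunE -(eqP (eqf _)).
    by rewrite permKV.
  by rewrite (bigD1 i) //= (negPf ne_i) mul0r.
rewrite /hodge; under eq_bigr => f _ do rewrite monof mulr_suml.
rewrite exchange_big /=.
rewrite (eq_bigr (fun=> altsum g [tuple of etuple p s ++ v])).
  rewrite sumr_const card_Sn -(mulr_natl (altsum _ _)) mulrA mulVf ?mul1r //.
  by rewrite pnatr_eq0 -lt0n fact_gt0.
move=> t _.
rewrite (bigD1 [ffun i => fs ((t^-1)%g i)]) //= eqxx mulr1 big1 ?addr0; last first.
  by move=> f /negPf->; rewrite mulr0 mul0r.
set w := [tuple of etuple p s ++ v].
have -> : [tuple of [tuple tnth d ([ffun i => fs ((t^-1)%g i)] i) | i < p] ++ v]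
    = [tuple tnth w (block_perm (t^-1)%g 1%g i) | i < p + q].
  apply: eq_from_tnth => i; rewrite tnth_mktuple -[i]splitK.
  case: (fintype.split i) => j /=.
    rewrite block_permL !tnth_lshift !tnth_mktuple !ffunE tnth_d /=.
    have /(allP si) /andP[] : nth 0%N s ((t^-1)%g j) \in s by rewrite mem_nth ?sz.
    by case: (nth _ _ _).
  by rewrite block_permR !tnth_rshift perm1.
rewrite altsum_perm sign_block_perm odd_perm1 odd_permV mulr1 mulrA.
by rewrite -expr2 sqrr_sign mul1r.
Qed.

End Monomials.
Arguments mono {R V} e p s _.
Arguments crd {R V} e i x.
Arguments evec {R V} e i.
Arguments etuple {R V} e n w.

(** * Linear combinations of monomials *)

Section Forms.
Context {R : realType} {V : vectType R} (e : 7.-tuple V).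

(** Constant-coefficient forms are kept as lists of coefficients and words, so
    that wedge products and Hodge stars of concrete forms reduce by
    computation. *)
Definition form (p : nat) (L : seq (R * seq nat)) : kform V p :=
  fun v => \sum_(x <- L) x.1 * mono e p x.2 v.
Arguments form p L : clear implicits.

Lemma wedge_form p q L M : all (fun x => size x.2 == p) L ->
  wedge (form p L) (form q M) =
  form (p + q) [seq (x.1 * y.1, x.2 ++ y.2) | x <- L, y <- M].
Proof.
move=> szL; apply: funext => v; rewrite /form big_allpairs_dep /=.
rewrite [RHS]big_seq; under eq_bigr => x xL do under eq_bigr => y _ do
  rewrite -(wedge_mono _ _ _ (eqP (allP szL x xL))) /wedge mulrCA.
rewrite -big_seq; under eq_bigr => x _ do rewrite -mulr_sumr.
rewrite -mulr_sumr; congr (_ * _).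
under eq_bigr => s _ do rewrite -mulrA big_distrlr /= mulr_sumr.
rewrite exchange_big; apply: eq_bigr => x _ /=.
under eq_bigr => s _ do rewrite mulr_sumr.
rewrite exchange_big; apply: eq_bigr => y _ /=.
rewrite mulr_sumr; apply: eq_bigr => s _.
by move: ((-1) ^+ s) => u; ring.
Qed.

(** A monomial with a repeated letter is zero, hence the zero coefficient
    where contract fails. *)
Definition star (L : seq (R * seq nat)) : seq (R * seq nat) :=
  [seq if contract x.2 (iota 1 7) is Some (b, l)
       then ((-1) ^+ b * x.1, l) else (0, [::]) | x <- L].

Hypothesis e_basis : basis_of fullv e.

Lemma hodge_form p q (d : (p + q).-tuple V) L :
    (p + q = 7)%N -> tval d = tval e ->
    all (fun x => all is_index x.2 && (size x.2 == p)) L ->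
  @hodge R V p q d (mono e (p + q) (iota 1 7)) (form p L) = form q (star L).
Proof.
move=> pq7 de okL; apply: funext => v; rewrite /hodge.
under eq_bigr => f _ do rewrite /form mulr_suml.
rewrite exchange_big [RHS]/form /star big_map mulr_sumr /= big_seq [RHS]big_seq.
apply: eq_bigr => x /(allP okL) /andP[ix /eqP sx].
transitivity (x.1 * @hodge R V p q d (mono e (p + q) (iota 1 7)) (mono e p x.2) v).
  rewrite /hodge mulrCA; congr (_ * _); rewrite mulr_sumr.
  by apply: eq_bigr => f _; rewrite mulrA.
rewrite hodge_monoE // -/(mono e (p + q) (iota 1 7)).
rewrite (@mono_contract _ _ e e_basis x.2 p q (iota 1 7) v) ?pq7 //.
  case: (contract _ _) => [[b l]|]; last by rewrite mulr0 mul0r.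
  by rewrite mulrCA mulrA.
by congr (_ ++ _); exact: map_etuple.
Qed.

End Forms.
Arguments form {R V} e p L _.

(** * The G2-structure and its torsion *)

Section G2Forms.
Context {R : realType} {V : vectType R} (e : 7.-tuple V).
Hypothesis e_basis : basis_of fullv e.

Lemma volumeE : volume e = mono e 7 (iota 1 7).
Proof. exact: (dual_monoE e (iota 1 7)). Qed.

Definition phi_terms : seq (R * seq nat) :=
  [:: (1, [:: 1; 2; 7]%N); (1, [:: 3; 4; 7]%N); (1, [:: 5; 6; 7]%N);
      (1, [:: 1; 3; 5]%N); (-1, [:: 1; 4; 6]%N);
      (-1, [:: 2; 3; 6]%N); (-1, [:: 2; 4; 5]%N)].

Lemma g2_phiE : g2_phi e = form e 3 phi_terms.
Proof.
rewrite /g2_phi !dual_monoE; apply: funext => v.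
rewrite /form !big_cons big_nil /= !fctE /=; ring.
Qed.

Lemma g2_psiE : g2_psi e = form e 4 (star phi_terms).
Proof. by rewrite /g2_psi g2_phiE volumeE; exact: hodge_form. Qed.

(** The values of monomials of degree 2, 3, 4 on vectors with coordinate
    functions X, Y, Z, W: minors, expanded along their first column. *)
Definition det2 (i j : nat) (X Y : nat -> R) := X i * Y j - X j * Y i.

Definition det3 (i j k : nat) (X Y Z : nat -> R) :=
  X i * det2 j k Y Z - X j * det2 i k Y Z + X k * det2 i j Y Z.

Definition det4 (i j k l : nat) (X Y Z W : nat -> R) :=
  X i * det3 j k l Y Z W - X j * det3 i k l Y Z W
  + X k * det3 i j l Y Z W - X l * det3 i j k Y Z W.

Lemma mono1E i x : mono e 1 [:: i] [tuple x] = crd e i x.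
Proof. by rewrite mono_expand // big_ord1 mono0 /= expr0; ring. Qed.

Lemma mono2E i j x y :
  mono e 2 [:: i; j] [tuple x; y] = det2 i j (crd e ^~ x) (crd e ^~ y).
Proof.
rewrite mono_expand // !big_ord_recl big_ord0 /= !mono1E /det2 /=; ring.
Qed.

Lemma mono3E i j k x y z :
  mono e 3 [:: i; j; k] [tuple x; y; z] =
  det3 i j k (crd e ^~ x) (crd e ^~ y) (crd e ^~ z).
Proof.
rewrite mono_expand // !big_ord_recl big_ord0 /= !mono2E /det3 /=; ring.
Qed.

Lemma mono4E i j k l x y z w :
  mono e 4 [:: i; j; k; l] [tuple x; y; z; w] =
  det4 i j k l (crd e ^~ x) (crd e ^~ y) (crd e ^~ z) (crd e ^~ w).
Proof.
rewrite mono_expand // !big_ord_recl big_ord0 /= !mono3E /det4 /=; ring.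
Qed.

End G2Forms.

Section StructureEquations.
Context {R : realType} {V : vectType R} (e : 7.-tuple V) (br : V -> V -> V).
Context (a b c : R).
Hypothesis e_basis : basis_of fullv e.
Hypothesis de_closed :
  forall i : nat, (1 <= i <= 6)%N -> ce_diff br (dual_form e i) = 0.
Hypothesis de_7 :
  ce_diff br (dual_form e 7)
    = (fun v => a * dual_mono e [:: 1; 2]%N v + b * dual_mono e [:: 3; 4]%N v
                + c * dual_mono e [:: 5; 6]%N v).

Lemma ce_diff1E (w : kform V 1) x y :
  ce_diff br w [tuple x; y] = - w [tuple br x y].
Proof.
rewrite /ce_diff; under eq_bigr => i _ do rewrite big_mkcond.
rewrite !big_ord_recl !big_ord0 /= !(tnth_nth 0) /= expr1 mulN1r !addr0.
by congr (- w _); apply: val_inj; rewrite /= enum_ord0.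
Qed.

Lemma ce_diff3E (w : kform V 3) x y z t :
  ce_diff br w [tuple x; y; z; t] =
  - w [tuple br x y; z; t] + w [tuple br x z; y; t] - w [tuple br x t; y; z]
  - w [tuple br y z; x; t] + w [tuple br y t; x; z] - w [tuple br z t; x; y].
Proof.
have tuple3E u (f : 'I_2 -> V) :
    [tuple of u :: [tuple f m | m < 2]] = [tuple u; f ord0; f (lift ord0 ord0)].
  by apply: val_inj; rewrite /= !enum_ordSl enum_ord0.
rewrite /ce_diff; under eq_bigr => i _ do rewrite big_mkcond.
rewrite !big_ord_recl !big_ord0 !tuple3E !(tnth_nth 0) /=.
ring.
Qed.

Definition de7_poly (X Y : nat -> R) : R :=
  a * det2 1 2 X Y + b * det2 3 4 X Y + c * det2 5 6 X Y.

(** The hypotheses on the differentials of the dual basis say what the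
    bracket is, since d xi (x, y) = - xi ([x, y]). *)
Lemma crd_br i x y : is_index i ->
  crd e i (br x y) = if i == 7%N then - de7_poly (crd e ^~ x) (crd e ^~ y) else 0.
Proof.
move=> ii.
have := ce_diff1E (dual_form e i) x y; case: (i =P 7%N) => [-> | ne7]; last first.
  rewrite de_closed => [/esym/eqP|]; first by rewrite oppr_eq0 => /eqP.
  by case/andP: ii => -> /=; rewrite leq_eqVlt => /predU1P[].
rewrite de_7 !(dual_monoE e [:: _; _]) !(mono2E e _ _ x y) -/(de7_poly _ _) => ->.
by rewrite opprK.
Qed.

(** The bracket takes values in the line of e_7, where phi restricts to
    omega = e^{12} + e^{34} + e^{56}; this is the form omega /\ de^7. *)
Lemma dphiE :
  ce_diff br (g2_phi e) =
  form e 4 [:: (a + b, [:: 1; 2; 3; 4]%N); (a + c, [:: 1; 2; 5; 6]%N);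
               (b + c, [:: 3; 4; 5; 6]%N)].
Proof.
apply: funext => v.
have [x [y [z [t ->]]]] : exists x y z t, v = [tuple x; y; z; t].
  case: v => [[|x [|y [|z [|t []]]]] // sz]; exists x, y, z, t.
  exact: val_inj.
rewrite ce_diff3E g2_phiE /form !big_cons !big_nil /= !mono3E !mono4E.
rewrite /det4 /det3 /det2 !crd_br //= /de7_poly /det2.
ring.
Qed.

(** Here *(d phi /\ phi) = 2 mu, and *d phi has coefficients b + c, a + c and
    a + b on e^{127}, e^{347} and e^{567}; for instance
    mu / 3 - (b + c) = a - 2 mu / 3. *)
Definition torsion_poly (X Y Z : nat -> R) : R :=
  let mu := a + b + c in
  (a - 2 / 3 * mu) * det3 1 2 7 X Y Z + (b - 2 / 3 * mu) * det3 3 4 7 X Y Z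
  + (c - 2 / 3 * mu) * det3 5 6 7 X Y Z
  + mu / 3 * (det3 1 3 5 X Y Z - det3 1 4 6 X Y Z - det3 2 3 6 X Y Z
              - det3 2 4 5 X Y Z).

Lemma g2_torsionE x y z :
  g2_torsion br e [tuple x; y; z] =
  torsion_poly (crd e ^~ x) (crd e ^~ y) (crd e ^~ z).
Proof.
rewrite /g2_torsion dphiE g2_phiE wedge_form // volumeE.
rewrite (@hodge_form _ _ e e_basis 7 0) // (@hodge_form _ _ e e_basis 4 3) //.
rewrite /form /star /= !big_cons !big_nil /= !mono0 !mono3E /torsion_poly.
by field.
Qed.

End StructureEquations.

(** * The instanton condition as linear equations *)

Lemma contract_rest s l b l' : contract s l = Some (b, l') ->
  all is_index l -> size l = (size s + size l')%N /\ all is_index l'.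
Proof.
elim: s l b => [|a s IHs] l b /=; first by move=> [_ <-].
case: ifP => // al; case E: (contract _ _) => [[b1 l1]|] // [_ eq_l] il.
rewrite {}eq_l in E.
have [|sl il1] := IHs _ _ E; first by apply/allP => x /mem_rem /(allP il).
by split=> //; rewrite addSn -sl size_rem // prednK // lt0n size_eq0; case: (l) al.
Qed.

Section WedgeWithPsi.
Context {R : realType} {V : vectType R} (e : 7.-tuple V).
Hypothesis e_basis : basis_of fullv e.

(** On basis vectors the matrix of coordinates is a 0-1 matrix recording
    equality of letters, so words and vectors play symmetric roles. *)
Lemma mono_transpose n s w : size s = n -> size w = n ->
    all is_index s -> all is_index w ->
  mono e n s (etuple e n w) = mono e n w (etuple e n s).
Proof.
move=> ss sw si wi; rewrite !mono_det -det_tr; congr (\det _).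
apply/matrixP => i j; rewrite !mxE !tnth_mktuple.
have isi k : (k < n)%N -> is_index (nth 0%N s k).
  by move=> ?; rewrite (allP si) // mem_nth ?ss.
have iwi k : (k < n)%N -> is_index (nth 0%N w k).
  by move=> ?; rewrite (allP wi) // mem_nth ?sw.
by rewrite !crd_evec ?isi ?iwi // eq_sym.
Qed.

(** A rotation by two places is the square of a permutation, hence even. *)
Lemma mono_rot2 l x y z t u v :
  mono e 6 l [tuple z; t; u; v; x; y] = mono e 6 l [tuple x; y; z; t; u; v].
Proof.
pose r : 'S_6 := perm (@ordS_inj 6).
transitivity (mono e 6 l [tuple tnth [tuple x; y; z; t; u; v] ((r * r)%g i) | i < 6]).
  congr (mono e 6 l _); apply: val_inj.
  by rewrite /= !enum_ordSl enum_ord0 /= !permM !permE !(tnth_nth 0).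
by rewrite /mono altsum_perm odd_permM addbb mul1r.
Qed.

Lemma wedge_formr p q (al : kform V p) (M : seq (R * seq nat)) v :
  wedge al (form e q M) v = \sum_(x <- M) x.1 * wedge al (mono e q x.2) v.
Proof.
rewrite /wedge /form; under eq_bigr => s _ do rewrite mulr_sumr.
rewrite exchange_big mulr_sumr /=; apply: eq_bigr => x _.
rewrite mulrCA; congr (_ * _); rewrite mulr_sumr; apply: eq_bigr => s _.
by rewrite mulrCA.
Qed.

Lemma sum_delta (F : nat -> R) k : is_index k ->
  \sum_(i <- iota 1 7) F i * (i == k)%:R = F k.
Proof.
move=> ik; have kI : k \in iota 1 7 by rewrite mem_iota.
rewrite (bigD1_seq k) ?iota_uniq //= eqxx mulr1 big1 ?addr0 // => i.
by move=> /negPf->; rewrite mulr0.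
Qed.

Section Antisymmetric.
Context (al : kform V 2).
Hypothesis al_anti : forall i j, is_index i -> is_index j ->
  al [tuple evec e i; evec e j] = - al [tuple evec e j; evec e i].

(** The factor one half makes up for counting every pair of indices twice. *)
Definition al_terms : seq (R * seq nat) :=
  [seq (2^-1 * al [tuple evec e i; evec e j], [:: i; j])
    | i <- iota 1 7, j <- iota 1 7].

Lemma al_termsE i j : is_index i -> is_index j ->
  form e 2 al_terms [tuple evec e i; evec e j] = al [tuple evec e i; evec e j].
Proof.
move=> ii ij; rewrite /form /al_terms big_allpairs_dep.
pose A k l := 2^-1 * al [tuple evec e k; evec e l].
transitivity (\sum_(k <- iota 1 7) ((A k j) * (k == i)%:R - A k i * (k == j)%:R)).
  rewrite big_seq [RHS]big_seq; apply: eq_bigr => k.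
  rewrite mem_iota => /andP[k1 k7].
  have ik : is_index k by rewrite /is_index k1 -ltnS.
  rewrite -(sum_delta (A k) ij) -(sum_delta (A k) ii) !mulr_suml -sumrB.
  rewrite big_seq [RHS]big_seq; apply: eq_bigr => l.
  rewrite mem_iota => /andP[l1 l7].
  have il : is_index l by rewrite /is_index l1 -ltnS.
  rewrite /= mono2E /det2 !crd_evec // /A; ring.
rewrite sumrB (sum_delta (A^~ j)) // (sum_delta (A^~ i)) // /A.
by rewrite (al_anti ij ii); field.
Qed.

(** On basis vectors al can be replaced by the combination of monomials
    e^{ij} above. By mono_transpose, e^{ijt} on the vectors of w is the
    monomial of w on e_i, e_j and the vectors of t. Contracting w with t leaves
    a two-letter word kl, and summing over i and j then restores the value of
    al at (e_k, e_l). *)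
Lemma wedge_contract t w :
    uniq w -> all is_index w -> all is_index t -> size w = 6%N -> size t = 4%N ->
  wedge al (mono e 4 t) (etuple e 6 w) =
  if contract t w is Some (b, [:: k; l]) then
    (-1) ^+ b * al [tuple evec e k; evec e l]
  else 0.
Proof.
move=> uw iw it sw st.
have iwi k : (k < 6)%N -> is_index (nth 0%N w k).
  by move=> ?; rewrite (allP iw) // mem_nth ?sw.
have -> : wedge al (mono e 4 t) (etuple e 6 w) =
    wedge (form e 2 al_terms) (mono e 4 t) (etuple e 6 w).
  rewrite /wedge; congr (_ * _); apply: eq_bigr => s _; congr (_ * _ * _).
  have -> : [tuple tnth (etuple e 6 w) (s (lshift 4 i)) | i < 2] =
      [tuple evec e (nth 0%N w (s (lshift 4 ord0)));
             evec e (nth 0%N w (s (lshift 4 (lift ord0 ord0))))].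
    by apply: val_inj; rewrite /= !enum_ordSl enum_ord0 /= !tnth_mktuple.
  by rewrite al_termsE // iwi.
have -> : mono e 4 t = form e 4 [:: (1, t)].
  by apply: funext => v; rewrite /form big_seq1 mul1r.
rewrite wedge_form; last by apply/allP => x /allpairsP[[i j] [_ _ ->]].
have -> : form e (2 + 4) [seq (x.1 * y.1, x.2 ++ y.2) | x <- al_terms, y <- [:: (1, t)]]
     (etuple e 6 w) = \sum_(x <- al_terms)
       if contract t w is Some (b, l) then
         (-1) ^+ b * (x.1 * mono e 2 l (etuple e 2 x.2)) else 0.
  rewrite /form big_allpairs_dep big_seq [RHS]big_seq.
  apply: eq_bigr => _ /allpairsP[[i j] [iI jI ->]]; rewrite big_seq1 /= mulr1.
  have [ii ij] : is_index i /\ is_index j.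
    by move: iI jI; rewrite !mem_iota.
  rewrite (@mono_transpose 6 [:: i, j & t]) //= ?st ?ii ?ij //.
  case: t st it => [|t1 [|t2 [|t3 [|t4 []]]]] // _ it.
  have -> : etuple e 6 [:: i; j; t1; t2; t3; t4] = [tuple evec e i; evec e j;
      evec e t1; evec e t2; evec e t3; evec e t4].
    by apply: val_inj; exact: (@map_etuple _ _ e 6).
  rewrite -mono_rot2.
  rewrite (@mono_contract _ _ e e_basis [:: t1; t2; t3; t4] 4 2 w
             (etuple e 2 [:: i; j])) ?sw ?map_etuple //.
  case: (contract _ _) => [[b l]|]; last by rewrite mulr0.
  by rewrite mulrCA.
case E: (contract t w) => [[b l]|]; last by rewrite big1.
have [sl il] := contract_rest E iw.
case: l E sl il => [|k [|l []]] //; rewrite ?sw ?st // => E _ /and3P[ik il _].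
rewrite -al_termsE // mulr_sumr big_seq [RHS]big_seq.
apply: eq_bigr => _ /allpairsP[[i j] [iI jI ->]] /=; congr (_ * (_ * _)).
have [ii ij] : is_index i /\ is_index j.
  by move: iI jI; rewrite !mem_iota.
rewrite mono_transpose //= ?ik ?il ?ii ?ij //; congr (mono e 2 _ _).
by apply: val_inj; exact: (@map_etuple _ _ e 2).
Qed.

End Antisymmetric.

(** The three contractions of al with phi in the directions e_1, e_3 and
    e_5. They come from evaluating the 6-form on the six basis vectors other
    than e_1, e_3, e_5: the words of psi = *phi are the complements of the words
    of phi, so those of psi without the letter k leave behind, in turn, the
    pairs which complete k to a word of phi. *)
Lemma wedge_psi_contraction (al : kform V 2) :
    (forall i j, is_index i -> is_index j ->
       al [tuple evec e i; evec e j] = - al [tuple evec e j; evec e i]) ->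
    wedge al (g2_psi e) = 0 ->
  let A i j := al [tuple evec e i; evec e j] in
  [/\ A 2%N 7%N + A 3%N 5%N - A 4%N 6%N = 0,
      A 4%N 7%N - A 1%N 5%N + A 2%N 6%N = 0 &
      A 6%N 7%N + A 1%N 3%N - A 2%N 4%N = 0].
Proof.
move=> anti w0 A.
have E w : uniq w -> all is_index w -> size w = 6%N ->
    \sum_(x <- star (@phi_terms R)) x.1 *
      (if contract x.2 w is Some (b, [:: k; l]) then (-1) ^+ b * A k l else 0) = 0.
  move=> uw iw sw; transitivity (wedge al (g2_psi e) (etuple e 6 w)); last by rewrite w0.
  rewrite g2_psiE // wedge_formr; rewrite /star /= !big_cons !big_nil /=.
  by rewrite !wedge_contract.
split.
- have := E [:: 2; 3; 4; 5; 6; 7]%N erefl erefl erefl.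
  by rewrite /star /= !big_cons big_nil /=; lra.
- have := E [:: 1; 2; 4; 5; 6; 7]%N erefl erefl erefl.
  by rewrite /star /= !big_cons big_nil /=; lra.
- have := E [:: 1; 2; 3; 4; 6; 7]%N erefl erefl erefl.
  by rewrite /star /= !big_cons big_nil /=; lra.
Qed.

End WedgeWithPsi.

(** * Connection and curvature as polynomials *)

Section ConnectionPolynomials.
Context {R : realType} (a b c lambda : R).

Definition basis_coords (i : nat) : nat -> R := fun m => (m == i)%:R.

(** g(nabla^lambda_x y, z) in coordinates. As [x, y] = - F(x, y) e_7, the
    first summand is the Koszul formula for left-invariant fields. *)
Definition conn_poly (X Y Z : nat -> R) : R :=
  2^-1 * (- de7_poly a b c X Y * Z 7%N + de7_poly a b c Y Z * X 7%N
          - de7_poly a b c Z X * Y 7%N)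
  + lambda / 2 * torsion_poly a b c X Y Z.

Definition conn_coords (X Y : nat -> R) : nat -> R :=
  fun m => if is_index m then conn_poly X Y (basis_coords m) else 0.

(** The last sign is positive because [x, y] = - F(x, y) e_7. *)
Definition curvature_poly (X Y U W : nat -> R) : R :=
  conn_poly X (conn_coords Y U) W - conn_poly Y (conn_coords X U) W
  + de7_poly a b c X Y * conn_poly (basis_coords 7) U W.

Let mu := a + b + c.
Let rho p := (lambda * (p - 2 / 3 * mu) - p) / 2.
Let sigma := lambda * mu / 6.

Ltac expand_connection :=
  rewrite /conn_poly /torsion_poly /de7_poly /det3 /det2 /basis_coords /=;
  rewrite /rho /sigma /mu; by field.

(** Each nabla_{e_i} is a skew endomorphism, written as a 2-form in Y and Z.
    These short forms keep the polynomials that enter the curvature small.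
    The combination rho p is half of lambda times the torsion coefficient
    p - 2 mu / 3, corrected by the Levi-Civita part - p / 2; in the direction
    e_7 that part has the opposite sign, whence rho p + p. *)
Lemma conn_poly1 Y Z : conn_poly (basis_coords 1) Y Z =
  rho a * det2 2 7 Y Z + sigma * (det2 3 5 Y Z - det2 4 6 Y Z).
Proof. by expand_connection. Qed.

Lemma conn_poly2 Y Z : conn_poly (basis_coords 2) Y Z =
  - rho a * det2 1 7 Y Z - sigma * (det2 3 6 Y Z + det2 4 5 Y Z).
Proof. by expand_connection. Qed.

Lemma conn_poly3 Y Z : conn_poly (basis_coords 3) Y Z =
  rho b * det2 4 7 Y Z - sigma * (det2 1 5 Y Z - det2 2 6 Y Z).
Proof. by expand_connection. Qed.

Lemma conn_poly4 Y Z : conn_poly (basis_coords 4) Y Z =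
  - rho b * det2 3 7 Y Z + sigma * (det2 1 6 Y Z + det2 2 5 Y Z).
Proof. by expand_connection. Qed.

Lemma conn_poly5 Y Z : conn_poly (basis_coords 5) Y Z =
  rho c * det2 6 7 Y Z + sigma * (det2 1 3 Y Z - det2 2 4 Y Z).
Proof. by expand_connection. Qed.

Lemma conn_poly6 Y Z : conn_poly (basis_coords 6) Y Z =
  - rho c * det2 5 7 Y Z - sigma * (det2 1 4 Y Z + det2 2 3 Y Z).
Proof. by expand_connection. Qed.

Lemma conn_poly7 Y Z : conn_poly (basis_coords 7) Y Z =
  (rho a + a) * det2 1 2 Y Z + (rho b + b) * det2 3 4 Y Z
  + (rho c + c) * det2 5 6 Y Z.
Proof. by expand_connection. Qed.

Let conn_polyE := (conn_poly1, conn_poly2, conn_poly3, conn_poly4, conn_poly5,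
  conn_poly6, conn_poly7).

Let Rm i j u v := curvature_poly (basis_coords i) (basis_coords j)
  (basis_coords u) (basis_coords v).

Ltac expand_curvature :=
  rewrite /Rm /curvature_poly !conn_polyE /det2 /conn_coords /= !conn_polyE;
  rewrite /de7_poly /det2 /basis_coords /=;
  rewrite ?(mulr0, mul0r, mulr1, mul1r, addr0, add0r, subr0, sub0r, oppr0);
  rewrite /rho /sigma /mu; by field.

(** The curvature contracted with phi in the directions e_1, e_3, e_5, in the
    entries where these contractions give conditions on a, b, c and lambda;
    the factor 12 clears denominators. *)
Lemma contracted_curvature_27 :
  12 * (Rm 2 7 2 7 + Rm 3 5 2 7 - Rm 4 6 2 7) =
  (lambda + 1) * (2 * lambda * mu * (mu - a) + 3 * (lambda - 1) * a ^+ 2).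
Proof. by expand_curvature. Qed.

Lemma contracted_curvature_47 :
  12 * (Rm 4 7 4 7 - Rm 1 5 4 7 + Rm 2 6 4 7) =
  (lambda + 1) * (2 * lambda * mu * (mu - b) + 3 * (lambda - 1) * b ^+ 2).
Proof. by expand_curvature. Qed.

Lemma contracted_curvature_67 :
  12 * (Rm 6 7 6 7 + Rm 1 3 6 7 - Rm 2 4 6 7) =
  (lambda + 1) * (2 * lambda * mu * (mu - c) + 3 * (lambda - 1) * c ^+ 2).
Proof. by expand_curvature. Qed.

Lemma contracted_curvature_35 :
  12 * (Rm 2 7 3 5 + Rm 3 5 3 5 - Rm 4 6 3 5) =
  lambda * (lambda - 3) * mu * (b + c) - 3 * (lambda - 1) ^+ 2 * (b * c).
Proof. by expand_curvature. Qed.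

Lemma contracted_curvature_51 :
  12 * (Rm 4 7 5 1 - Rm 1 5 5 1 + Rm 2 6 5 1) =
  lambda * (lambda - 3) * mu * (a + c) - 3 * (lambda - 1) ^+ 2 * (a * c).
Proof. by expand_curvature. Qed.

Lemma contracted_curvature_13 :
  12 * (Rm 6 7 1 3 + Rm 1 3 1 3 - Rm 2 4 1 3) =
  lambda * (lambda - 3) * mu * (a + b) - 3 * (lambda - 1) ^+ 2 * (a * b).
Proof. by expand_curvature. Qed.

End ConnectionPolynomials.

(** * The curvature of the connection *)

Section Metric.
Context {R : realType} {V : vectType R} (e : 7.-tuple V).
Hypothesis e_basis : basis_of fullv e.

Lemma metricC x y : metric e x y = metric e y x.
Proof. by apply: eq_bigr => i _; rewrite mulrC. Qed.

Lemma metricBl x y z : metric e (x - y) z = metric e x z - metric e y z.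
Proof. by rewrite /metric -sumrB; apply: eq_bigr => i _; rewrite raddfB mulrBl. Qed.

Lemma metric_evec x i : metric e x (evec e i) = crd e i x.
Proof.
rewrite /metric (bigD1 (inord i.-1)) //= /evec (tnth_nth 0).
rewrite coord_free ?(basis_free e_basis) // eqxx mulr1 big1 ?addr0 // => j ne_j.
by rewrite coord_free ?(basis_free e_basis) // eq_sym (negPf ne_j) mulr0.
Qed.

Lemma metric_crd x y : metric e x y = \sum_(i <- iota 1 7) crd e i x * crd e i y.
Proof.
rewrite (iotaDl 1 0) big_map -[iota 0 7]/(index_iota 0 7) big_mkord.
by apply: eq_bigr => i _; rewrite /crd /= inord_val.
Qed.

(** For left-invariant fields the inner products are constant, so the
    derivative terms of the Koszul formula vanish. *)
Lemma koszul (br D : V -> V -> V) x y z : levi_civita br (metric e) D ->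
  metric e (D x y) z =
  2^-1 * (metric e (br x y) z - metric e (br y z) x + metric e (br z x) y).
Proof.
case=> tf mc.
have T u v w : metric e (br u v) w = metric e (D u v) w - metric e (D v u) w.
  by rewrite -tf metricBl.
have M u v w : metric e (D u v) w = - metric e (D u w) v.
  by apply/eqP; rewrite -addr_eq0 [metric e (D u w) v]metricC mc.
rewrite !T (M z x y) (M y z x) (M x z y).
by field.
Qed.

End Metric.

Section Curvature.
Context {R : realType} {V : vectType R} (e : 7.-tuple V) (br : V -> V -> V).
Context (a b c lambda : R) (nablag nabla : V -> V -> V).
Hypothesis e_basis : basis_of fullv e.
Hypothesis de_closed :
  forall i : nat, (1 <= i <= 6)%N -> ce_diff br (dual_form e i) = 0.
Hypothesis de_7 :
  ce_diff br (dual_form e 7)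
    = (fun v => a * dual_mono e [:: 1; 2]%N v + b * dual_mono e [:: 3; 4]%N v
                + c * dual_mono e [:: 5; 6]%N v).
Hypothesis nablag_lc : levi_civita br (metric e) nablag.
Hypothesis nablaE : nabla_lambda br e nablag lambda nabla.

(** The coordinates are cut off outside the range 1..7, so that those of a
    basis vector are literally a Kronecker delta (coords_evec). *)
Definition coords (x : V) : nat -> R :=
  fun i => if is_index i then crd e i x else 0.

Lemma coords_evec i : is_index i -> coords (evec e i) = basis_coords i.
Proof.
move=> ii; apply: funext => m; rewrite /coords /basis_coords.
by case: ifP => im; [rewrite crd_evec | case: eqP im => // ->; rewrite ii].
Qed.

Lemma metric_br x y z :
  metric e (br x y) z = - de7_poly a b c (coords x) (coords y) * coords z 7.
Proof.
rewrite metric_crd [LHS]/= !big_cons big_nil !(crd_br de_closed de_7) //=.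
by rewrite !mul0r !add0r addr0.
Qed.

Lemma metric_nabla x y z :
  metric e (nabla x y) z = conn_poly a b c lambda (coords x) (coords y) (coords z).
Proof.
rewrite nablaE (koszul _ _ _ nablag_lc) !metric_br.
rewrite (g2_torsionE e_basis de_closed de_7).
by rewrite /conn_poly !mulNr opprK.
Qed.

Lemma coords_nabla x y :
  coords (nabla x y) = conn_coords a b c lambda (coords x) (coords y).
Proof.
apply: funext => m; rewrite {1}/coords /conn_coords; case: ifP => // im.
by rewrite -(metric_evec e_basis) metric_nabla coords_evec.
Qed.

Lemma curvature_formE x y u v :
  curvature_form br e nabla u v [tuple x; y] =
  curvature_poly a b c lambda (coords x) (coords y) (coords u) (coords v).
Proof.
rewrite /curvature_form !(tnth_nth 0) /= /curvature !metricBl !metric_nabla.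
rewrite !coords_nabla /curvature_poly.
have -> : coords (br x y) =
    (fun m => - de7_poly a b c (coords x) (coords y) * basis_coords 7 m).
  apply: funext => m; rewrite {1}/coords; case: ifP => im.
    rewrite (crd_br de_closed de_7) //.
    by rewrite /basis_coords; case: eqP; rewrite ?mulr1 ?mulr0.
  by rewrite /basis_coords; case: eqP im => [->|]; rewrite ?mulr0.
rewrite /conn_poly /torsion_poly /de7_poly /det3 /det2 /=.
by field.
Qed.

End Curvature.
Arguments coords {R V} e x.

(** * The scalar equations *)

Section ScalarSystem.
Context {R : realType} (a b c lambda : R).
Let mu := a + b + c.

Lemma instanton_system_solution :
  ~ (a = 0 /\ b = 0 /\ c = 0) ->
  (lambda + 1) * (2 * lambda * mu * (mu - a) + 3 * (lambda - 1) * a ^+ 2) = 0 ->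
  (lambda + 1) * (2 * lambda * mu * (mu - b) + 3 * (lambda - 1) * b ^+ 2) = 0 ->
  (lambda + 1) * (2 * lambda * mu * (mu - c) + 3 * (lambda - 1) * c ^+ 2) = 0 ->
  lambda * (lambda - 3) * mu * (b + c) - 3 * (lambda - 1) ^+ 2 * (b * c) = 0 ->
  lambda * (lambda - 3) * mu * (a + c) - 3 * (lambda - 1) ^+ 2 * (a * c) = 0 ->
  lambda * (lambda - 3) * mu * (a + b) - 3 * (lambda - 1) ^+ 2 * (a * b) = 0 ->
  lambda = 1 /\ mu = 0.
Proof.
move=> abc0 Ea Eb Ec Fa Fb Fc.
pose sq := a ^+ 2 + b ^+ 2 + c ^+ 2.
have sq_neq0 : sq != 0.
  apply/eqP => sq0; apply: abc0.
  have [a2 b2 c2] : [/\ 0 <= a ^+ 2, 0 <= b ^+ 2 & 0 <= c ^+ 2] by rewrite !sqr_ge0.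
  have zero (x : R) : x ^+ 2 = 0 -> x = 0 by move/eqP; rewrite expf_eq0 => /eqP.
  by rewrite /sq in sq0; split; [|split]; apply: zero; lra.
pose e2 := a * b + b * c + c * a.
have muE : mu ^+ 2 = sq + 2 * e2 by rewrite /mu /sq /e2; ring.
have F : 2 * lambda * (lambda - 3) * mu ^+ 2 = 3 * (lambda - 1) ^+ 2 * e2.
  by move: Fa Fb Fc; rewrite /mu /e2; lra.
have E : (lambda + 1) * (4 * lambda * mu ^+ 2 + 3 * (lambda - 1) * sq) = 0.
  by move: Ea Eb Ec; rewrite /mu /sq; lra.
have [lm1 | lm1] := eqVneq (lambda + 1) 0.
  have l : lambda = -1 by lra.
  (* For lambda = -1 the sum of the second family reads 2 mu^2 = 3 e2. *)
  have : mu ^+ 2 + 3 * sq = 0.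
    by move: F; rewrite muE l => F; lra.
  have := sqr_ge0 mu; have : 0 < sq.
    by rewrite lt_def sq_neq0 /sq !addr_ge0 ?sqr_ge0.
  by move=> *; lra.
have {}E : 4 * lambda * mu ^+ 2 + 3 * (lambda - 1) * sq = 0.
  by move/eqP: E; rewrite mulf_eq0 (negPf lm1) => /eqP.
have mu0 : mu = 0.
  have P : (3 * lambda ^+ 2 + 2 * lambda + 3) * mu ^+ 2 = 0.
    have -> : (3 * lambda ^+ 2 + 2 * lambda + 3) * mu ^+ 2
      = 3 * (lambda - 1) ^+ 2 * (mu ^+ 2 - sq - 2 * e2)
        + (lambda - 1) * (4 * lambda * mu ^+ 2 + 3 * (lambda - 1) * sq)
        - 2 * (2 * lambda * (lambda - 3) * mu ^+ 2 - 3 * (lambda - 1) ^+ 2 * e2).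
      ring.
    rewrite E F muE; ring.
  move/eqP: P; rewrite mulf_eq0 expf_eq0 /= => /orP[/eqP P | /eqP //].
  (* 3 (3 lambda^2 + 2 lambda + 3) = (3 lambda + 1)^2 + 8 > 0 *)
  by have := sqr_ge0 (3 * lambda + 1); nra.
split=> //; move/eqP: E; rewrite mu0 expr0n /= mulr0 add0r mulf_eq0 (negPf sq_neq0).
by rewrite orbF mulf_eq0 pnatr_eq0 /= subr_eq0 => /eqP.
Qed.
End ScalarSystem.

Theorem lemma3p2 (R : realType) (V : vectType R)
    (br : {bilinear V -> V -> V}) (e : 7.-tuple V) (a b c lambda : R)
    (nablag : {bilinear V -> V -> V}) (nabla : V -> V -> V) :
  lie_bracket br ->
  two_step_nilpotent br ->
  basis_of fullv e ->
  (forall i : nat, (1 <= i <= 6)%N -> ce_diff br (dual_form e i) = 0) ->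
  ce_diff br (dual_form e 7)
    = (fun v => a * dual_mono e [:: 1; 2]%N v + b * dual_mono e [:: 3; 4]%N v
                + c * dual_mono e [:: 5; 6]%N v) ->
  ~ (a = 0 /\ b = 0 /\ c = 0) ->
  levi_civita br (metric e) nablag ->
  nabla_lambda br e nablag lambda nabla ->
  g2_instanton br e nabla ->
  let mu := a + b + c in
  lambda = 1 /\ mu = 0.
Proof.
move=> _ _ e_basis de_closed de_7 abc0 lc nablaE instanton.
pose Rm i j u v := curvature_poly a b c lambda (basis_coords i) (basis_coords j)
  (basis_coords u) (basis_coords v).
have RmE i j u v : is_index i -> is_index j -> is_index u -> is_index v ->
    curvature_form br e nabla (evec e u) (evec e v) [tuple evec e i; evec e j] =
    Rm i j u v.
  move=> *; rewrite (curvature_formE e_basis de_closed de_7 lc nablaE).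
  by rewrite !(coords_evec e_basis).
have eqs u v : is_index u -> is_index v ->
    [/\ Rm 2%N 7%N u v + Rm 3%N 5%N u v - Rm 4%N 6%N u v = 0,
        Rm 4%N 7%N u v - Rm 1%N 5%N u v + Rm 2%N 6%N u v = 0 &
        Rm 6%N 7%N u v + Rm 1%N 3%N u v - Rm 2%N 4%N u v = 0].
  move=> iu iv.
  have := wedge_psi_contraction e_basis _ (instanton (evec e u) (evec e v)).
  rewrite /= !RmE //; apply=> i j ii ij; rewrite !RmE //.
  by rewrite /Rm /curvature_poly /de7_poly /det2; ring.
apply: instanton_system_solution abc0 _ _ _ _ _ _.
- by have [E _ _] := eqs 2%N 7%N erefl erefl;
  rewrite -contracted_curvature_27 E mulr0.
- by have [_ E _] := eqs 4%N 7%N erefl erefl;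
  rewrite -contracted_curvature_47 E mulr0.
- by have [_ _ E] := eqs 6%N 7%N erefl erefl;
  rewrite -contracted_curvature_67 E mulr0.
- by have [E _ _] := eqs 3%N 5%N erefl erefl;
  rewrite -contracted_curvature_35 E mulr0.
- by have [_ E _] := eqs 5%N 1%N erefl erefl;
  rewrite -contracted_curvature_51 E mulr0.
- by have [_ _ E] := eqs 1%N 3%N erefl erefl;
  rewrite -contracted_curvature_13 E mulr0.
Qed.
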